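(* Let $R:\mathbb{R}^n\to\mathbb{R}\cup\{+\infty\}$ be proper, lower semicontinuous and bounded from below, let $F:\mathbb{R}^n\to\mathbb{R}$ be differentiable with $L$-Lipschitz continuous gradient, and assume $\Phi=R+F$ is a proper lower semicontinuous KL function bounded from below. Run the MiFB algorithm with $s\ge1$ and with $\mu,\nu>0$, $\gamma_k,a_{i,k},b_{i,k}$ such that $\underline\beta-\sum_{i\in I}\bar\alpha_i>0$, and suppose that the generated sequence $\{x_k\}_{k\in\mathbb{N}}$ converges to a critical point $x^\star\in\mathrm{crit}(\Phi)$. Assume that $R\in\mathrm{PSF}_{x^\star,-\nabla F(x^\star)}(\mathcal{M}_{x^\star})$, i.e. $R$ is partly smooth at $x^\star$ relative to $\mathcal{M}_{x^\star}$ for $-\nabla F(x^\star)$, and that the non-degeneracy condition $$-\nabla F(x^\star)\in\mathrm{ri}\big(\partial R(x^\star)\big)$$ holds. Then $x_k\in\mathcal{M}_{x^\star}$ for all $k$ large enough.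
   Context: $\mathbb{R}^n$ carries the standard inner product and norm. No convexity is assumed. $\mathrm{ri}$ denotes relative interior; $\mathrm{par}(\Omega)=\mathbb{R}(\Omega-\Omega)$ is the subspace parallel to a nonempty closed convex set $\Omega$. Proximity operator (set-valued): $\mathrm{prox}_{\gamma R}(z)=\mathrm{Argmin}_{x\in\mathbb{R}^n}\ \tfrac12\|x-z\|^2+\gamma R(x)$. MiFB algorithm: let $s\ge1$ be an integer, $I=\{0,1,\dots,s-1\}$, $x_0\in\mathbb{R}^n$, $x_{-s}=\dots=x_{-1}=x_0$. For each $k\in\mathbb{N}$ take $\gamma_k$ with $0<\underline\gamma\le\gamma_k\le\bar\gamma<\frac1L$, and $a_{i,k},b_{i,k}\in\,]-1,2]$ for $i\in I$, and set $$y_{a,k}=x_k+\sum_{i\in I}a_{i,k}(x_{k-i}-x_{k-i-1}),\quad y_{b,k}=x_k+\sum_{i\in I}b_{i,k}(x_{k-i}-x_{k-i-1}),\quad x_{k+1}\in\mathrm{prox}_{\gamma_kR}\big(y_{a,k}-\gamma_k\nabla F(y_{b,k})\big).$$ Constants: for $\mu,\nu>0$, $$\beta_k=\frac{1-\gamma_kL-\mu-\nu\gamma_k}{2\gamma_k},\quad \underline\beta=\liminf_{k}\beta_k,\quad \alpha_{k,i}=\frac{s\,a_{i,k}^2}{2\gamma_k\mu}+\frac{s\,b_{i,k}^2L^2}{2\nu},\quad \bar\alpha_i=\limsup_k\alpha_{k,i}.$$ Subdifferentials: for $J$ lower semicontinuous and $x\in\mathrm{dom}(J)$, the Fréchet subdifferential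 $\partial^FJ(x)$ is the set of $v$ with $\liminf_{z\to x,z\ne x}\frac{1}{\|x-z\|}(J(z)-J(x)-\langle v,z-x\rangle)\ge0$; the (limiting) subdifferential is $\partial J(x)=\{v:\exists x_k\to x,\ J(x_k)\to J(x),\ v_k\in\partial^FJ(x_k),\ v_k\to v\}$. $J$ is regular at $x$ if $\partial^FJ(x)=\partial J(x)$. $\mathrm{dom}(\partial J)=\{x:\partial J(x)\neq\emptyset\}$, $\mathrm{crit}(J)=\{x:0\in\partial J(x)\}$. KL property: a proper lower semicontinuous $J$ has the Kurdyka–Łojasiewicz property at $\bar x\in\mathrm{dom}(J)$ if there are $\eta\in\,]0,+\infty]$, a neighbourhood $U$ of $\bar x$ and a continuous concave $\varphi:[0,\eta[\to\mathbb{R}_+$ such that $\varphi(0)=0$, $\varphi$ is $C^1$ on $]0,\eta[$ with $\varphi'>0$ there, and for all $x\in U$ with $J(\bar x)<J(x)<J(\bar x)+\eta$, $\varphi'(J(x)-J(\bar x))\,\mathrm{dist}(0,\partial J(x))\ge1$. $J$ is a KL function if it has this property at each point of $\mathrm{dom}(\partial J)$. Prox-regularity: $R$ is $r$-prox-regular at $\bar x\in\mathrm{dom}(R)$ for $\bar v\in\partial R(\bar x)$ ($r>0$) if $R(x')\ge R(x)+\langle v,x'-x\rangle-\frac1{2r}\|x-x'\|^2$ for all $x,x'$ near $\bar x$ with $R(x)$ near $R(\bar x)$ and all $v\in\partial R(x)$ near $\bar v$. Partial smoothness: $R$ is ($C^2$-)partly smooth at $\bar x\in\mathcal{M}$ relative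 to $\mathcal{M}\subset\mathbb{R}^n$ for $\bar v\in\partial R(\bar x)\ne\emptyset$, written $R\in\mathrm{PSF}_{\bar x,\bar v}(\mathcal{M})$, if $\mathcal{M}$ is a $C^2$-submanifold around $\bar x$ and: (smoothness) $R$ restricted to $\mathcal{M}$ is $C^2$ around $\bar x$; (regularity) $R$ is regular at all $x\in\mathcal{M}$ near $\bar x$ and $R$ is $r$-prox-regular at $\bar x$ for $\bar v$ (for some $r>0$); (sharpness) the tangent space of $\mathcal{M}$ at $\bar x$ satisfies $\mathcal{T}_{\mathcal{M}}(\bar x)=\mathrm{par}(\partial R(\bar x))^\perp$; (continuity) the set-valued mapping $\partial R$ is continuous at $\bar x$ relative to $\mathcal{M}$. *)

(* Defs.v *)
From HB Require Import structures.
From mathcomp Require Import all_boot all_order all_algebra.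
From mathcomp Require Import all_classical all_reals all_analysis.

Set Implicit Arguments.
Unset Strict Implicit.
Unset Printing Implicit Defensive.

Import Order.TTheory GRing.Theory Num.Theory.
Import numFieldNormedType.Exports.

Local Open Scope classical_set_scope.
Local Open Scope ring_scope.

(* MathComp-Analysis norms 'rV[R]_n with the max norm.  The topology is the
   usual one, so limits, neighbourhoods and differentials are taken from the
   library, but every quantitative norm must be [enorm]. *)
Definition dot (R : realType) (n : nat) (u v : 'rV[R]_n) : R :=
  \sum_(i < n) u 0 i * v 0 i.

Definition enorm (R : realType) (n : nat) (u : 'rV[R]_n) : R :=
  Num.sqrt (dot u u).

(* <grad F x, v> = 'd F x v whenever F is differentiable at x. *)
Definition grad (R : realType) (n : nat) (F : 'rV[R]_n -> R) (x : 'rV[R]_n) :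
    'rV[R]_n :=
  \row_(i < n) 'd F x (delta_mx 0 i).

Definition lipschitz_gradient (R : realType) (n : nat) (L : R)
    (F : 'rV[R]_n -> R) : Prop :=
  (forall x, differentiable F x) /\
  (forall x y, enorm (grad F x - grad F y) <= L * enorm (x - y)).

Section ExtendedValued.
Context {R : realType} {n : nat}.
Implicit Types (J : 'rV[R]_n -> \bar R) (x v : 'rV[R]_n).

Definition proper_fun J : Prop :=
  (forall x, J x != -oo%E) /\ (exists x, (J x < +oo)%E).

Definition bounded_below J : Prop := exists c : R, forall x, (c%:E <= J x)%E.

Definition dom J : set 'rV[R]_n := [set x | J x \is a fin_num].

Definition frechet_subdiff J x : set 'rV[R]_n :=
  [set v | dom J x /\
    (0 <= limf_einf (fun z : 'rV[R]_n =>
      (enorm (x - z))^-1%:E * (J z - J x - (dot v (z - x))%:E)) x^')%E].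

Definition subdiff J x : set 'rV[R]_n :=
  [set v | dom J x /\ exists u w : nat -> 'rV[R]_n,
    [/\ u @ \oo --> x,
        (fun k => J (u k)) @ \oo --> J x,
        forall k, frechet_subdiff J (u k) (w k)
      & w @ \oo --> v]].

Definition regular_at J x : Prop := frechet_subdiff J x = subdiff J x.

Definition dom_subdiff J : set 'rV[R]_n := [set x | subdiff J x !=set0].

Definition crit J : set 'rV[R]_n := [set x | subdiff J x 0].

Definition dist0 (A : set 'rV[R]_n) : \bar R :=
  ereal_inf [set (enorm v)%:E | v in A].

(* [phi] is a function on the whole line of which only the values on
   [0, eta[ matter. *)
Definition desingularizing (eta : \bar R) (phi : R -> R) : Prop :=
  let D := [set t : R | 0 <= t /\ (t%:E < eta)%E] in
  [/\ forall t, D t -> 0 <= phi t,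
      {within D, continuous phi},
      convex_function (D : set (convex_lmodType R^o)) (fun t => - phi t),
      phi 0 = 0
    & forall t, 0 < t -> (t%:E < eta)%E ->
        [/\ derivable phi t 1, {for t, continuous (derive1 phi)} & 0 < derive1 phi t]].

Definition KL_at J xbar : Prop :=
  exists (eta : \bar R) (U : set 'rV[R]_n) (phi : R -> R),
    [/\ (0 < eta)%E, nbhs xbar U, desingularizing eta phi
      & forall x, U x -> (J xbar < J x)%E -> (J x < J xbar + eta)%E ->
          (1 <= (derive1 phi (fine (J x - J xbar)))%:E * dist0 (subdiff J x))%E].

Definition KL_function J : Prop := forall x, dom_subdiff J x -> KL_at J x.

Definition prox_regular J (r : R) xbar vbar : Prop :=
  [/\ 0 < r, dom J xbar, subdiff J xbar vbar
    & exists2 e : R, 0 < e & forall x x' v,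
        enorm (x - xbar) < e -> enorm (x' - xbar) < e ->
        (`|J x - J xbar| < e%:E)%E ->
        subdiff J x v -> enorm (v - vbar) < e ->
        (J x + (dot v (x' - x) - (2 * r)^-1 * enorm (x - x') ^+ 2)%:E
           <= J x')%E].

Definition prox (g : R) J (z : 'rV[R]_n) : set 'rV[R]_n :=
  [set x | forall y,
    ((2^-1 * enorm (x - z) ^+ 2)%:E + g%:E * J x
       <= (2^-1 * enorm (y - z) ^+ 2)%:E + g%:E * J y)%E].

End ExtendedValued.

Section ConvexSets.
Context {R : realType} {n : nat}.
Implicit Types A : set 'rV[R]_n.

Definition affine_set A : Prop :=
  forall x y (t : R), A x -> A y -> A ((1 - t) *: x + t *: y).

Definition aff A : set 'rV[R]_n :=
  [set x | forall B, affine_set B -> A `<=` B -> B x].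

Definition ri A : set 'rV[R]_n :=
  [set x | aff A x /\ \forall z \near x, aff A z -> A z].

Definition par A : set 'rV[R]_n :=
  [set w | exists (t : R) (u v : 'rV[R]_n), [/\ A u, A v & w = t *: (u - v)]].

Definition orth A : set 'rV[R]_n := [set w | forall u, A u -> dot u w = 0].

End ConvexSets.

Section Manifolds.
Context {R : realType} {n : nat}.

(* In finite dimension, continuity of y |-> 'd f y is the same as continuity
   of y |-> 'd f y v for every v. *)
Definition C1_on (V : normedModType R) (U : set 'rV[R]_n) (f : 'rV[R]_n -> V) :
    Prop :=
  (forall x, U x -> differentiable f x) /\
  (forall v x, U x -> {for x, continuous (fun y => 'd f y v)}).

Definition C2_on (V : normedModType R) (U : set 'rV[R]_n) (f : 'rV[R]_n -> V) :
    Prop :=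
  C1_on U f /\ forall v, C1_on U (fun y => 'd f y v).

Definition local_equation (M : set 'rV[R]_n) (x : 'rV[R]_n) (m : nat)
    (h : 'rV[R]_n -> 'rV[R]_m) : Prop :=
  exists U : set 'rV[R]_n,
    [/\ open_nbhs x U, C2_on U h, forall z, U z -> (M z <-> h z = 0)
      & forall w, exists v, 'd h x v = w].

Definition C2_submanifold_at (M : set 'rV[R]_n) (x : 'rV[R]_n) : Prop :=
  M x /\ exists (m : nat) (h : 'rV[R]_n -> 'rV[R]_m), local_equation M x h.

(* The kernel of 'd h x is the same for all local equations h of M at x. *)
Definition tangent_space (M : set 'rV[R]_n) (x : 'rV[R]_n) : set 'rV[R]_n :=
  [set v | exists (m : nat) (h : 'rV[R]_n -> 'rV[R]_m),
     local_equation M x h /\ 'd h x v = 0].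

Definition C2_along (M : set 'rV[R]_n) (x : 'rV[R]_n) (J : 'rV[R]_n -> \bar R) :
    Prop :=
  exists (U : set 'rV[R]_n) (g : 'rV[R]_n -> R),
    [/\ open_nbhs x U, C2_on U g & forall z, U z -> M z -> J z = (g z)%:E].

Definition outer_limit (M : set 'rV[R]_n) (x : 'rV[R]_n)
    (S : 'rV[R]_n -> set 'rV[R]_n) : set 'rV[R]_n :=
  [set v | exists u w : nat -> 'rV[R]_n,
     [/\ forall k, M (u k), u @ \oo --> x, forall k, S (u k) (w k)
       & w @ \oo --> v]].

Definition inner_limit (M : set 'rV[R]_n) (x : 'rV[R]_n)
    (S : 'rV[R]_n -> set 'rV[R]_n) : set 'rV[R]_n :=
  [set v | forall u : nat -> 'rV[R]_n, (forall k, M (u k)) -> u @ \oo --> x ->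
     exists w : nat -> 'rV[R]_n,
       (\forall k \near \oo, S (u k) (w k)) /\ w @ \oo --> v].

Definition setvalued_continuous_at (M : set 'rV[R]_n) (x : 'rV[R]_n)
    (S : 'rV[R]_n -> set 'rV[R]_n) : Prop :=
  outer_limit M x S = S x /\ inner_limit M x S = S x.

Definition partly_smooth (J : 'rV[R]_n -> \bar R) (xbar vbar : 'rV[R]_n)
    (M : set 'rV[R]_n) : Prop :=
  subdiff J xbar vbar /\
  [/\ C2_submanifold_at M xbar,
      C2_along M xbar J,
      (\forall x \near xbar, M x -> regular_at J x) /\
        (exists r : R, prox_regular J r xbar vbar),
      tangent_space M xbar = orth (par (subdiff J xbar))
    & setvalued_continuous_at M xbar (subdiff J)].

End Manifolds.

Section MiFB.
Context {R : realType} {n : nat}.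

Definition objective (Rf : 'rV[R]_n -> \bar R) (F : 'rV[R]_n -> R) :
    'rV[R]_n -> \bar R :=
  fun x => (Rf x + (F x)%:E)%E.

(* Truncated subtraction encodes the convention x_{-s} = ... = x_{-1} = x_0. *)
Definition inertial_point (s : nat) (c : 'I_s -> nat -> R)
    (x : nat -> 'rV[R]_n) (k : nat) : 'rV[R]_n :=
  x k + \sum_(i < s) c i k *: (x (k - i)%N - x (k - i - 1)%N).

Definition MiFB (Rf : 'rV[R]_n -> \bar R) (F : 'rV[R]_n -> R) (s : nat)
    (gamma : nat -> R) (a b : 'I_s -> nat -> R) (x : nat -> 'rV[R]_n) : Prop :=
  forall k, prox (gamma k) Rf
    (inertial_point a x k - gamma k *: grad F (inertial_point b x k)) (x k.+1).

End MiFB.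

Section Constants.
Context {R : realType}.

Definition beta (L mu nu : R) (gamma : nat -> R) (k : nat) : R :=
  (1 - gamma k * L - mu - nu * gamma k) / (2 * gamma k).

Definition alpha (L mu nu : R) (gamma : nat -> R) (s : nat)
    (a b : 'I_s -> nat -> R) (i : 'I_s) (k : nat) : R :=
  s%:R * a i k ^+ 2 / (2 * gamma k * mu) + s%:R * b i k ^+ 2 * L ^+ 2 / (2 * nu).

Definition beta_inf (L mu nu : R) (gamma : nat -> R) : \bar R :=
  limn_einf (fun k => (beta L mu nu gamma k)%:E).

Definition alpha_sup (L mu nu : R) (gamma : nat -> R) (s : nat)
    (a b : 'I_s -> nat -> R) (i : 'I_s) : \bar R :=
  limn_esup (fun k => (alpha L mu nu gamma a b i k)%:E).

End Constants.

(* Main.v *)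
(** The optimality condition of the proximal step says that
    [v_k = (y_{a,k} - gamma_k grad F (y_{b,k}) - x_{k+1}) / gamma_k] satisfies
    [Rf y >= Rf x_{k+1} + <v_k, y - x_{k+1}> - |y - x_{k+1}|^2 / (2 gamma_k)]
    for every [y], and [v_k] tends to [- grad F xstar] because [x_k] converges.
    Newton's chord iteration on a local equation of [M] gives points [p_k] of
    [M], converging to [xstar], such that [d_k = x_{k+1} - p_k] is normal to
    [M] at [xstar].  By sharpness and nondegeneracy,
    [- grad F xstar + u] and [- grad F xstar - u] are subgradients at [xstar]
    for every small normal vector [u]; by continuity of the subdifferential
    along [M] they are limits of subgradients at [p_k].  Adding the
    prox-regularity inequality at [p_k] to the proximal one yields
    [|<u, d_k>| <= o(|d_k|)] for all the vectors [u] of a basis of the normal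
    space, whence [d_k = 0] for all large [k]. *)

Require Import Defs.
From HB Require Import structures.
From mathcomp Require Import all_boot all_order all_algebra.
From mathcomp Require Import all_classical all_reals all_analysis.
From mathcomp Require Import lra ring.

Set Implicit Arguments.
Unset Strict Implicit.
Unset Printing Implicit Defensive.

Import Order.TTheory GRing.Theory Num.Theory.
Import numFieldNormedType.Exports.

Local Open Scope classical_set_scope.
Local Open Scope ring_scope.

(** * The Euclidean inner product and its comparison with the max norm *)

Section Euclid.
Context {R : realType} {n : nat}.
Implicit Types u v w : 'rV[R]_n.

Lemma dotE u v : dot u v = (u *m v^T) 0 0.
Proof. by rewrite mxE; apply: eq_bigr => i _; rewrite mxE. Qed.

Lemma dotC u v : dot u v = dot v u.
Proof. by apply: eq_bigr => i _; rewrite mulrC. Qed.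

Lemma dotDr u v w : dot u (v + w) = dot u v + dot u w.
Proof. by rewrite !dotE linearD mulmxDr mxE. Qed.

Lemma dotZr c u v : dot u (c *: v) = c * dot u v.
Proof. by rewrite !dotE linearZ -scalemxAr mxE. Qed.

Lemma dotNr u v : dot u (- v) = - dot u v.
Proof. by rewrite -scaleN1r dotZr mulN1r. Qed.

Lemma dotBr u v w : dot u (v - w) = dot u v - dot u w.
Proof. by rewrite dotDr dotNr. Qed.

Lemma dotDl u v w : dot (u + v) w = dot u w + dot v w.
Proof. by rewrite dotC dotDr !(dotC w). Qed.

Lemma dotZl c u v : dot (c *: u) v = c * dot u v.
Proof. by rewrite dotC dotZr dotC. Qed.

Lemma dotBl u v w : dot (u - v) w = dot u w - dot v w.
Proof. by rewrite dotC dotBr !(dotC w). Qed.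

Lemma dotNl u v : dot (- u) v = - dot u v.
Proof. by rewrite dotC dotNr dotC. Qed.

Lemma dot_ge0 u : 0 <= dot u u.
Proof. by apply: sumr_ge0 => i _; rewrite -expr2 sqr_ge0. Qed.

Lemma enorm_sqr u : enorm u ^+ 2 = dot u u.
Proof. by rewrite sqr_sqrtr // dot_ge0. Qed.

Lemma enormB u v : enorm (u - v) = enorm (v - u).
Proof. by rewrite /enorm -opprB dotNl dotNr opprK. Qed.

Lemma coord_le_norm u i : `|u 0 i| <= `|u|.
Proof.
by rewrite [leRHS]/Num.norm /= mx_normrE; apply/bigmax_geP; right; exists (0, i).
Qed.

Lemma norm_le_coord u c : 0 <= c -> (forall i, `|u 0 i| <= c) -> `|u| <= c.
Proof.
move=> c0 uc; rewrite [leLHS]/Num.norm /= mx_normrE; apply/bigmax_leP; split=> //.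
by move=> [i j] _ /=; rewrite ord1.
Qed.

Lemma norm_dot_le u v : `|dot u v| <= n%:R * `|u| * `|v|.
Proof.
apply: le_trans (ler_norm_sum _ _ _) _.
apply: (@le_trans _ _ (\sum_(i < n) `|u| * `|v|)); last first.
  by rewrite sumr_const card_ord -mulrA mulr_natl.
by apply: ler_sum => i _; rewrite normrM ler_pM ?coord_le_norm.
Qed.

Lemma sqr_norm_le_dot u : `|u| ^+ 2 <= dot u u.
Proof.
rewrite -enorm_sqr lerXn2r ?nnegrE ?sqrtr_ge0 //.
apply: norm_le_coord => [|i]; first exact: sqrtr_ge0.
rewrite -sqrtr_sqr ler_wsqrtr // /dot (bigD1 i) //= -expr2 lerDl.
by apply: sumr_ge0 => j _; rewrite -expr2 sqr_ge0.
Qed.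

Lemma norm_le_enorm u : `|u| <= enorm u.
Proof.
by rewrite -(ler_pXn2r (_ : 0 < 2)%N) ?nnegrE ?sqrtr_ge0 // enorm_sqr sqr_norm_le_dot.
Qed.

Lemma enorm_le_norm u : enorm u <= n%:R * `|u|.
Proof.
rewrite -(ler_pXn2r (_ : 0 < 2)%N) ?nnegrE ?sqrtr_ge0 ?mulr_ge0 //.
rewrite enorm_sqr (le_trans (ler_norm _)) // (le_trans (norm_dot_le _ _)) //.
rewrite exprMn -mulrA -expr2 ler_wpM2r ?sqr_ge0 //.
by rewrite -natrX ler_nat; case: (n) => // k; rewrite leq_pmulr.
Qed.

(** Converts max-norm closeness, as produced by limits, into Euclidean closeness. The divisor n + 1
    stays positive when n = 0. *)
Lemma enorm_lt u e : `|u| < e / (n%:R + 1) -> enorm u < e.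
Proof.
rewrite ltr_pdivlMr ?ltr_wpDl // => lte; apply: le_lt_trans lte.
by apply: le_trans (enorm_le_norm _) _; rewrite mulrC ler_wpM2l // lerDl.
Qed.

End Euclid.

Section NormMulmx.
Context {R : realType} {n m : nat}.

Lemma norm_mulmx_le (K : 'M[R]_(n, m)) :
  exists2 c : R, 0 < c & forall w : 'rV[R]_n, `|w *m K| <= c * `|w|.
Proof.
exists (n%:R * `|K| + 1) => [|w]; first by rewrite ltr_wpDl // mulr_ge0.
apply: norm_le_coord => [|j]; first by rewrite mulr_ge0 // addr_ge0 // mulr_ge0.
have -> : (w *m K) 0 j = dot w (row j K^T).
  by rewrite mxE; apply: eq_bigr => i _; rewrite !mxE.
apply: le_trans (norm_dot_le _ _) _.
rewrite mulrAC ler_wpM2r // ler_wpDr // ler_wpM2l //.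
apply: norm_le_coord => // i; rewrite !mxE.
by rewrite [leRHS]/Num.norm /= mx_normrE; apply/bigmax_geP; right; exists (i, j).
Qed.

End NormMulmx.

(** * Biorthogonals, affine hulls and right inverses *)

Section Orthogonality.
Context {R : realType}.

Definition linear_set {n} (V : set 'rV[R]_n) :=
  V 0 /\ forall (c : R) u v, V u -> V v -> V (c *: u + v).

(* A matrix of maximal rank among those whose row space lies in V spans V. *)
Lemma linear_set_span {n} (V : set 'rV[R]_n) :
  linear_set V -> exists A : 'M[R]_n, forall u, V u <-> (u <= A)%MS.
Proof.
move=> [V0 Vlin].
pose P k := `[< exists A : 'M[R]_n, \rank A = k /\ forall u, (u <= A)%MS -> V u >].
have P0 : exists k, P k.
  by exists 0%N; apply/asboolP; exists 0; rewrite mxrank0; split => // u;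
    rewrite submx0 => /eqP ->.
have Pn k : P k -> (k <= n)%N by move=> /asboolP[A [<- _]]; exact: rank_leq_col.
case: (ex_maxnP P0 Pn) => k /asboolP[A [rkA AV]] kmax.
exists A => u; split; last exact: AV.
move=> Vu; apply: contrapT => /negP uA.
have /kmax : P (\rank (A + u)%MS).
  apply/asboolP; exists (A + u)%MS; split => // z /sub_addsmxP[[c d]] /= ->.
  rewrite addrC (mx11_scalar d) mul_scalar_mx; apply: Vlin => //.
  by apply: AV; rewrite submxMl.
rewrite -rkA leqNgt => /negP; apply.
have : (A < A + u)%MS.
  rewrite ltmxE addsmxSl /=; apply: contra uA; apply: submx_trans.
  exact: addsmxSr.
exact: rank_ltmx.
Qed.

(** If V is the row space of A, the columns of [cokermx A] are orthogonal to V. Hence u is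
    orthogonal to them, and being killed by [cokermx A] means lying in the row space of A. *)
Lemma orth_orth_linear {n} (V : set 'rV[R]_n) :
  linear_set V -> orth (orth V) `<=` V.
Proof.
move=> /linear_set_span[A VA] u uV; apply/VA; rewrite submxE.
apply/eqP/rowP => j; rewrite [RHS]mxE.
have -> : (u *m cokermx A) 0 j = dot (row j (cokermx A)^T) u.
  by rewrite dotC mxE; apply: eq_bigr => i _; rewrite !mxE.
apply: uV => v /VA/submxP[c ->].
have -> : dot (c *m A) (row j (cokermx A)^T) = (c *m A *m cokermx A) 0 j.
  by rewrite [RHS]mxE; apply: eq_bigr => i _; rewrite !mxE.
by rewrite -mulmxA mulmx_coker mulmx0 mxE.
Qed.

(** Scaling moves along the line through v and v + x; a sum is reached by going from v to the
    midpoint of the two points and then twice as far. *)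
Lemma affine_shift_linear {n} (B : set 'rV[R]_n) v :
  affine_set B -> B v -> linear_set [set z | B (v + z)].
Proof.
move=> Baff Bv; split => [|c x y] /=; first by rewrite addr0.
move=> Bx By.
have Bc : B (v + c *: x).
  have := Baff _ _ c Bv Bx; congr B.
  by rewrite scalerBl scale1r scalerDr addrA subrK.
have Bd : B (2^-1 *: (v + c *: x) + 2^-1 *: (v + y)).
  have := Baff _ _ 2^-1 Bc By; congr B; congr (_ *: _ + _); lra.
have := Baff _ _ 2 Bv Bd; congr B.
rewrite -scalerDr scalerA divff ?pnatr_eq0 // scale1r scalerBl scale1r.
by rewrite scaler_nat mulr2n; apply/rowP => i; rewrite !mxE; lra.
Qed.

(** An affine B containing A becomes, translated by - v, a linear space containing all differences
    of points of A. Its orthogonal thus lies in that of [par A], and taking orthogonals again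
    reverses the inclusion. *)
Lemma orth_orth_par_aff {n} (A : set 'rV[R]_n) v u :
  A v -> orth (orth (par A)) u -> aff A (v + u).
Proof.
move=> Av uA B Baff AB.
have VB := affine_shift_linear Baff (AB _ Av).
suff: [set z | B (v + z)] u by [].
apply: (orth_orth_linear VB) => w wB; apply: uA => _ [t [x [y [Ax Ay ->]]]].
have sub z : A z -> dot (z - v) w = 0.
  by move=> Az; apply: wB; rewrite /= addrC subrK; exact: AB.
have -> : x - y = (x - v) - (y - v) by rewrite opprB addrA subrK.
by rewrite dotZl dotBl !sub // subrr mulr0.
Qed.

(** K is the Moore-Penrose inverse of J, so its rows are orthogonal to the kernel of J. The Gram
    matrix is invertible: w J^T J = 0 forces w J^T = 0, and writing w = v J gives |w|^2 = w J^T v^T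
    = 0. *)
Lemma surjective_right_inverse {n m} (J : 'M[R]_(n, m)) :
  (forall w : 'rV_m, exists v : 'rV_n, v *m J = w) ->
  exists2 K : 'M[R]_(m, n), K *m J = 1%:M &
    forall (v : 'rV_n) (w : 'rV_m), v *m J = 0 -> dot v (w *m K) = 0.
Proof.
move=> Jsurj; have JJ : J^T *m J \in unitmx.
  rewrite -row_free_unit -kermx_eq0; apply/eqP/row_matrixP => i.
  set w := row i _; have wJJ : w *m (J^T *m J) = 0.
    by rewrite -row_mul mulmx_ker row0.
  have wJ0 : w *m J^T = 0.
    apply/eqP; rewrite -normr_eq0 -sqrf_eq0 eq_le sqr_ge0 andbT.
    apply: le_trans (sqr_norm_le_dot _) _.
    by rewrite dotE trmx_mul trmxK mulmxA -(mulmxA w) wJJ mul0mx mxE.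
  have [v vJ] := Jsurj w.
  rewrite row0; apply/eqP; rewrite -normr_eq0 -sqrf_eq0 eq_le sqr_ge0 andbT.
  apply: le_trans (sqr_norm_le_dot _) _.
  by rewrite dotE -{2}vJ trmx_mul mulmxA wJ0 mul0mx mxE.
exists (invmx (J^T *m J) *m J^T); first by rewrite -mulmxA mulVmx.
move=> v w vJ; rewrite dotE mulmxA trmx_mul trmxK mulmxA vJ mul0mx mxE //.
Qed.

End Orthogonality.

(** * A fixed point theorem and strict differentiability *)

Section NewtonCorrection.
Context {R : realType}.

(** The estimate |g w| <= |g 0| + |w| / 2 maps the ball of radius rho into itself, so Banach's
    theorem applies; at the fixed point it also bounds |w| by 2 |g 0|. *)
Lemma ball_fixed_point {V : completeNormedModType R} (g : V -> V) (rho : R) :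
  (forall w w', `|w| <= rho -> `|w'| <= rho ->
     `|g w - g w'| <= 2^-1 * `|w - w'|) ->
  `|g 0| <= rho / 2 -> exists w, `|w| <= 2 * `|g 0| /\ g w = w.
Proof.
move=> g_lip g0; have rho0 : 0 <= rho by have := normr_ge0 (g 0); lra.
have g_le w : `|w| <= rho -> `|g w| <= `|g 0| + 2^-1 * `|w|.
  move=> wr; have := g_lip w 0 wr; rewrite normr0 subr0 => /(_ rho0) glip.
  by rewrite -[g w](subrK (g 0)) addrC (le_trans (ler_normD _ _)) // lerD2l.
pose U := closed_ball_ (fun v : V => `|v|) 0 rho.
have UE w : U w = (`|w| <= rho) by rewrite /U /closed_ball_ /= sub0r normrN.
have gU : set_fun U U g.
  by move=> w; rewrite UE => wU; rewrite UE; have := g_le w wU; lra.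
have h0 : 0 <= 2^-1 :> R by [].
have ctr : is_contraction (mkfun_fun gU).
  exists (NngNum h0); split => [|[w w'] /= [Uw Uw']]; first by rewrite /=; lra.
  by apply: g_lip; rewrite -UE; [exact: Uw|exact: Uw'].
have U0 : U !=set0 by exists 0; rewrite UE normr0.
have [w Uw /= gw] := banach_fixed_point ctr (@closed_closed_ball_ R V 0 rho) U0.
exists w; split => //; rewrite UE in Uw; move: (g_le w Uw); rewrite -{1}[g w]gw; lra.
Qed.

Lemma diff_jacobian {n m} (h : 'rV[R]_n -> 'rV[R]_m) (x d : 'rV[R]_n) :
  'd h x d = d *m jacobian h x.
Proof. by rewrite /jacobian mul_rV_lin1. Qed.

(** [C1_on] gives continuity of the differential one direction at a time. The n basis directions
    suffice for a bound uniform in d, with e / (n + 1) allotted to each. *)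
Lemma C1_on_jacobian_near {n m} (U : set 'rV[R]_n) (h : 'rV[R]_n -> 'rV[R]_m) (x : 'rV[R]_n)
    (e : R) :
  nbhs x U -> C1_on U h -> 0 < e ->
  \forall z \near x, forall d : 'rV[R]_n,
    `|d *m (jacobian h z - jacobian h x)| <= e * `|d|.
Proof.
move=> xU [hdiff hcont] e0; have Ux := nbhs_singleton xU.
pose e' := e / (n%:R + 1).
have n0 : 0 < n%:R + 1 :> R by rewrite ltr_wpDl.
have e'0 : 0 < e' by rewrite divr_gt0.
pose D (j : 'I_n) (z : 'rV[R]_n) : 'rV[R]_m := 'd h z (delta_mx 0 j).
have DE j z i : D j z 0 i = jacobian h z j i.
  by rewrite /D diff_jacobian -rowE mxE.
clearbody D.
have Dcont j : D j z @[z --> x] --> D j x.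
  have -> : D j = fun y => 'd h y (delta_mx 0 j).
    by apply/funext => y; apply/rowP => i; rewrite DE diff_jacobian -rowE [RHS]mxE.
  exact: hcont.
have Dx : \forall z \near x, forall j, `|D j z - D j x| < e'.
  apply: (@filter_forall _ _ _ (nbhs x) _) => j.
  have /cvgrPdistC_lt/(_ e' e'0) := Dcont j; exact.
apply: filterS Dx => z zj d.
have AE j i : (jacobian h z - jacobian h x) j i = (D j z - D j x) 0 i.
  by rewrite [LHS]mxE [X in _ + X]mxE [RHS]mxE [X in _ = _ + X]mxE !DE.
move: (jacobian h z - jacobian h x) AE => A AE.
apply: norm_le_coord => [|i]; first by rewrite mulr_ge0 // ltW.
rewrite mxE; apply: le_trans (ler_norm_sum _ _ _) _.
apply: (@le_trans _ _ (\sum_(j < n) e' * `|d|)).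
  apply: ler_sum => j _; rewrite normrM mulrC AE.
  rewrite ler_pM ?coord_le_norm //; apply: le_trans (ltW (zj j)).
  exact: coord_le_norm.
rewrite sumr_const card_ord -mulr_natl mulrA ler_wpM2r //.
by rewrite /e' mulrCA ger_pMr // ler_pdivrMr // mul1r lerDl.
Qed.

Lemma is_derive_line {V W : normedModType R} (f : V -> W) (y d : V)
    (t : R) :
  derivable f (y + t *: d) d ->
  is_derive t 1 (fun s : R => f (y + s *: d)) ('D_d f (y + t *: d)).
Proof.
move=> fd; have E : (fun s : R => s^-1 *: (((fun s : R => f (y + s *: d)) \o shift t) (s *: 1)
      - f (y + t *: d))) =
    (fun s : R => s^-1 *: ((f \o shift (y + t *: d)) (s *: d) - f (y + t *: d))).
  apply/funext => s /=; congr (_ *: (f _ - _)).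
  by rewrite scalerDl [s *: 1]mulr1 addrCA.
by apply: DeriveDef; rewrite /derivable /derive E.
Qed.

(** The mean value theorem is applied to each coordinate of h on the segment from y' to y. The
    intermediate point depends on the coordinate, which is harmless in the max norm. *)
Lemma C1_on_strict_diff {n m} (U : set 'rV[R]_n) (h : 'rV[R]_n -> 'rV[R]_m) (x : 'rV[R]_n)
    (e : R) :
  nbhs x U -> C1_on U h -> 0 < e ->
  exists2 r : R, 0 < r & forall y y' : 'rV[R]_n, `|y - x| < r -> `|y' - x| < r ->
    [/\ U y, U y' & `|h y - h y' - (y - y') *m jacobian h x| <= e * `|y - y'|].
Proof.
move=> xU hC1 e0; have := C1_on_jacobian_near xU hC1 e0.
move/(filterI xU)/nbhs_ballP => [r /= r0 xr]; exists r => // y y' yx y'x.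
have inball z : `|z - x| < r -> ball x r z by rewrite -ball_normE /= distrC.
split; [by case: (xr y (inball _ yx))|by case: (xr y' (inball _ y'x))|].
apply: norm_le_coord => [|i]; first by rewrite mulr_ge0 // ltW.
pose d := y - y'; pose line t := y' + t *: d.
have lineE t : line t - x = (1 - t) *: (y' - x) + t *: (y - x).
  by rewrite /line /d; apply/rowP => j; rewrite !mxE; ring.
have line_in (t : R) : 0 <= t <= 1 -> `|line t - x| < r.
  move=> /andP[t0 t1]; rewrite lineE (le_lt_trans (ler_normD _ _)) //.
  rewrite !normrZ !ger0_norm ?subr_ge0 //.
  have : (1 - t) * `|y' - x| <= (1 - t) * Num.max `|y' - x| `|y - x|.
    by rewrite ler_wpM2l ?subr_ge0 // le_max lexx.
  have : t * `|y - x| <= t * Num.max `|y' - x| `|y - x|.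
    by rewrite ler_wpM2l // le_max lexx orbT.
  have : Num.max `|y' - x| `|y - x| < r by rewrite gt_max yx y'x.
  lra.
have hl_drv (t : R) : 0 <= t <= 1 ->
    is_derive t 1 (fun t => h (line t) 0 i) ((d *m jacobian h (line t)) 0 i).
  move=> t01; have [/= Ut _] := xr _ (inball _ (line_in _ t01)).
  have hd := hC1.1 _ Ut.
  have hD : derivable h (line t) d by exact: diff_derivable.
  have -> : (d *m jacobian h (line t)) 0 i = 'D_d (fun z => h z 0 i) (line t).
    by rewrite -deriveEjacobian // derive_mx // mxE.
  exact: (is_derive_line ((derivable_mxP _ _ _).1 hD 0 i)).
have [||t t01] := @MVT R (fun t => h (line t) 0 i)
    (fun t => (d *m jacobian h (line t)) 0 i) 0 1 ltr01.
- move=> t; rewrite in_itv /= => /andP[t0 t1].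
  by apply: hl_drv; rewrite !ltW.
- apply: derivable_within_continuous => t; rewrite in_itv /= => t01.
  by have [] := hl_drv t t01.
rewrite in_itv /= in t01; case/andP: t01 => t0 t1.
rewrite subr0 mulr1 /line scale1r scale0r addr0 /d [y' + _]addrC.
rewrite subrK -/d -/(line t) => hy; have t01 : 0 <= t <= 1 by rewrite !ltW.
have [_ /= jac] := xr _ (inball _ (line_in t t01)).
apply: le_trans (jac d); apply: le_trans (coord_le_norm _ i).
suff -> : (h y - h y' - d *m jacobian h x) 0 i =
    (d *m (jacobian h (line t) - jacobian h x)) 0 i by [].
by rewrite mulmxBr [RHS]mxE -hy [LHS]mxE [X in X + _]mxE [X in _ + X + _]mxE.
Qed.

End NewtonCorrection.

(* The library makes matrices complete and normed, but omits the join. *)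
HB.instance Definition _ (R : realType) (m n : nat) :=
  Complete.copy 'M[R]_(m, n) 'M[R]_(m, n).

(** * Points of the manifold near a given point, and its tangent space *)

Section Manifold.
Context {R : realType} {n : nat}.

(* [w |-> w - h (z + w K)] is a 1/2-contraction of a small ball because
   [w |-> (w K) J] is the identity and h is strictly differentiable at x. *)
Lemma newton_correction {m} (U : set 'rV[R]_n) (h : 'rV[R]_n -> 'rV[R]_m)
    (x : 'rV[R]_n) (K : 'M[R]_(m, n)) :
  nbhs x U -> C1_on U h -> h x = 0 -> K *m jacobian h x = 1%:M ->
  \forall z \near x, exists w : 'rV[R]_m,
    [/\ U (z + w *m K), h (z + w *m K) = 0 & `|w| <= 2 * `|h z|].
Proof.
move=> xU hC1 hx KJ; have [c c0 Kc] := norm_mulmx_le K.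
(* The factor (2c)^-1 compensates |w K| <= c |w| and leaves the ratio 1/2. The radius rho satisfies
   c rho = r / 2, so z + w K stays within r of x when |z - x| < r / 2. *)
have e0 : 0 < (2 * c)^-1 by rewrite invr_gt0 mulr_gt0.
have [r r0 hr] := C1_on_strict_diff xU hC1 e0.
pose rho := r * (2 * c)^-1.
have rho0 : 0 < rho by rewrite mulr_gt0.
have hcont : h z @[z --> x] --> h x.
  by apply: differentiable_continuous; apply: hC1.1; exact: nbhs_singleton xU.
have near_h : \forall z \near x, `|h z| < rho / 2.
  have /cvgrPdistC_lt/(_ (rho / 2)) := hcont; rewrite hx divr_gt0 // => /(_ isT).
  by apply: filterS => z; rewrite subr0.
have near_x : \forall z \near x, `|z - x| < r / 2.
  have : z @[z --> x] --> x by exact: cvg_id.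
  by move=> /cvgrPdistC_lt/(_ (r / 2)); apply; rewrite divr_gt0.
apply: filterS2 near_h near_x => z hz zx.
have inr w : `|w| <= rho -> `|z + w *m K - x| < r.
  move=> wrho; rewrite addrAC (le_lt_trans (ler_normD _ _)) //.
  rewrite (splitr r) ltr_leD // (le_trans (Kc w)) //.
  apply: le_trans (ler_wpM2l (ltW c0) wrho) _.
  have -> : c * rho = r / 2 by rewrite /rho; field; rewrite gt_eqF.
  exact: lexx.
pose g (w : 'rV[R]_m) := w - h (z + w *m K).
have [] := @ball_fixed_point R 'rV[R]_m g rho.
- move=> w w' wr wr'.
  have [_ _ hd] := hr _ _ (inr w wr) (inr w' wr').
  have E : z + w *m K - (z + w' *m K) = (w - w') *m K.
    by rewrite opprD addrACA subrr add0r mulmxBl.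
  rewrite E -mulmxA KJ mulmx1 in hd.
  have -> : g w - g w' = - (h (z + w *m K) - h (z + w' *m K) - (w - w')).
    by apply/rowP => i; rewrite !mxE; ring.
  rewrite normrN (le_trans hd) //.
  apply: le_trans (ler_wpM2l (ltW e0) (Kc _)) _.
  have ec : (2 * c)^-1 * c = 2^-1 by field; rewrite gt_eqF.
  by rewrite mulrA ec.
- by rewrite /g mul0mx addr0 sub0r normrN ltW.
move=> w [wle gw]; exists w.
rewrite /g mul0mx addr0 sub0r normrN in wle.
have hw : h (z + w *m K) = 0.
  by move/eqP: gw; rewrite /g -subr_eq0 addrAC subrr add0r oppr_eq0 => /eqP.
split => //; have wr : `|w| <= rho by move: hz; lra.
by have [] := hr _ _ (inr w wr) (inr w wr).
Qed.

(** [tangent_space] uses some local equation h', whereas h is prescribed. Newton correction for h'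
    moves x + t v by o(t) to a point p of M; there h also vanishes, and its strict differentiability
    gives t |v J| = o(t). *)
Lemma tangent_space_sub_ker (M : set 'rV[R]_n) (x : 'rV[R]_n) {m}
    (h : 'rV[R]_n -> 'rV[R]_m) (v : 'rV[R]_n) :
  M x -> local_equation M x h -> tangent_space M x v ->
  v *m jacobian h x = 0.
Proof.
move=> Mx [U [[oU Ux] [hC1 _] MU _]] [m' [h' [[U' [[oU' U'x] [hC1' _] MU' surj']]]]].
rewrite diff_jacobian => vJ'.
have xU : nbhs x U by exact: open_nbhs_nbhs.
have xU' : nbhs x U' by exact: open_nbhs_nbhs.
have hx : h x = 0 by apply/MU.
have hx' : h' x = 0 by apply/MU'.
have [K' KJ' _] : exists2 K : 'M[R]_(m', n), K *m jacobian h' x = 1%:M &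
    forall (v : 'rV_n) (w : 'rV_m'), v *m jacobian h' x = 0 -> dot v (w *m K) = 0.
  apply: surjective_right_inverse => w; have [u uw] := surj' w.
  by exists u; rewrite -diff_jacobian.
have [c c0 cK] := norm_mulmx_le K'.
have [c1 c10 cJ] := norm_mulmx_le (jacobian h x).
(* A and B are chosen so that |p - x| <= t A and t |v J| <= t d B. Taking d = e / (B + e) below
   ensures both d <= 1 and d B <= e. *)
pose A := `|v| + 2 * c * `|v|; pose B := A + c1 * c * 2 * `|v|.
have A0 : 0 <= A by rewrite addr_ge0 // !mulr_ge0 // ltW.
have B0 : 0 <= B by rewrite addr_ge0 // !mulr_ge0 // ltW.
apply/eqP; rewrite -normr_le0; apply/ler_addgt0Pl => e e0.
pose d := e / (B + e).
have Be0 : 0 < B + e by rewrite ltr_wpDl.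
have d0 : 0 < d by rewrite divr_gt0.
have d1 : d <= 1 by rewrite ler_pdivrMr // mul1r lerDr.
have dB : d * B <= e by rewrite /d mulrAC ler_pdivrMr // ler_wpM2l ?lerDl // ltW.
have [r r0 hr] := C1_on_strict_diff xU hC1 d0.
have [r' r'0 hr'] := C1_on_strict_diff xU' hC1' d0.
have newt := newton_correction xU' hC1' hx' KJ'.
have line_cvg : x + t *: v @[t --> 0^'+] --> x.
  rewrite -[X in _ --> X]addr0 -(scale0r v); apply: cvgD; first exact: cvg_cst.
  by apply: cvgZr_tmp; apply: cvg_at_right_filter; exact: cvg_id.
have near_r : \forall t \near 0^'+, t * A < r.
  near=> t; have : t < r / (A + 1) by near: t; apply: nbhs_right_lt; rewrite divr_gt0 // ltr_wpDl.
  rewrite ltr_pdivlMr ?ltr_wpDl // mulrDr mulr1; apply: le_lt_trans.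
  by rewrite lerDl; near: t; exact: nbhs_right_ge.
have [t [t0 tA tr' [w [U'p hp wle]]]] : exists t : R, [/\ 0 < t, t * A < r,
    `|x + t *: v - x| < r' & exists w : 'rV[R]_m', [/\ U' (x + t *: v + w *m K'),
      h' (x + t *: v + w *m K') = 0 & `|w| <= 2 * `|h' (x + t *: v)|]].
  near (0 : R)^'+ => t; exists t; split.
  - by near: t; exact: nbhs_right_gt.
  - by near: t.
  - by near: t; move/cvgrPdistC_lt : line_cvg; exact.
  - by near: t; exact: line_cvg newt.
(* The first-order term of h' along v vanishes. *)
have hle : `|h' (x + t *: v)| <= d * (t * `|v|).
  have [||_ _] := hr' (x + t *: v) x; rewrite ?subrr ?normr0 //.
  rewrite hx' subr0 [x + _]addrC addrK -scalemxAl vJ' scaler0 subr0.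
  by rewrite normrZ (gtr0_norm t0) [t *: v + x]addrC.
set p := x + t *: v + w *m K' in U'p hp.
have pE : p - x = t *: v + w *m K' by rewrite /p addrAC [x + _]addrC addrK.
have wK : `|w *m K'| <= t * (2 * c * `|v|) * d.
  apply: le_trans (cK w) _; apply: le_trans (ler_wpM2l (ltW c0) wle) _.
  have := ler_wpM2l (ltW c0) hle; lra.
have px : `|p - x| <= t * A.
  rewrite pE (le_trans (ler_normD _ _)) // normrZ (gtr0_norm t0) /A mulrDr lerD2l.
  by apply: le_trans wK _; rewrite ler_piMr // !mulr_ge0 // ltW.
have [Up _ hd] : [/\ U p, U x & `|h p - h x - (p - x) *m jacobian h x| <= d * `|p - x|].
  by apply: hr; rewrite ?subrr ?normr0 // (le_lt_trans px).
have hp0 : h p = 0 by apply/MU => //; apply/MU'.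
rewrite hp0 hx subrr sub0r normrN in hd.
have vE : t *: (v *m jacobian h x) = (p - x) *m jacobian h x - w *m K' *m jacobian h x.
  by rewrite pE mulmxDl addrK scalemxAl.
have : t * `|v *m jacobian h x| <= t * (d * B).
  rewrite -{1}(gtr0_norm t0) -normrZ vE (le_trans (ler_normB _ _)) //.
  have := ler_wpM2l (ltW d0) px; have := ler_wpM2l (ltW c10) wK.
  have := cJ (w *m K'); move: hd; rewrite /B; lra.
by rewrite ler_pM2l // addr0 => vB; exact: le_trans vB dB.
Unshelve. all: by end_near.
Qed.

End Manifold.

(** * Normal directions and small displacements along them *)

Section Identification.
Context {R : realType} {n : nat}.

(** The two premises exclude X = -oo and X = +oo respectively. This allows two inequalities to be
    added around a value J (x k) not known to be finite. *)
Lemma ereal_sandwich (a s t : R) (X : \bar R) :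
  (a%:E + s%:E <= X -> X + t%:E <= a%:E -> (s + t <= 0)%R)%E.
Proof. by case: X => [r| |] //=; rewrite -!EFinD !lee_fin; lra. Qed.

Lemma dot_mulmx_rows {m} (w : 'rV[R]_m) (K : 'M[R]_(m, n)) (d : 'rV[R]_n) :
  dot (w *m K) d = dot w (\row_j dot (row j K) d).
Proof.
rewrite mulmx_sum_row [RHS]/dot.
under [RHS]eq_bigr do rewrite mxE -dotZl.
elim/big_rec2: _ => [|j y z _ <-]; last by rewrite dotDl.
by rewrite dotE mul0mx mxE.
Qed.

(** The whole half-line lies in the affine hull, and its points tend to v as t decreases to 0. The
    opposite direction is covered by applying this to - u. *)
Lemma ri_orth_orth_par (A : set 'rV[R]_n) (v u : 'rV[R]_n) :
  A v -> ri A v -> orth (orth (par A)) u -> \forall t \near 0^'+, A (v + t *: u).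
Proof.
move=> Av [_ riA] uA.
have line_cvg : v + t *: u @[t --> (0 : R)^'+] --> v.
  rewrite -[X in _ --> X]addr0 -(scale0r u); apply: cvgD; first exact: cvg_cst.
  by apply: cvgZr_tmp; apply: cvg_at_right_filter; exact: cvg_id.
near=> t; have : aff A (v + t *: u) -> A (v + t *: u).
  by near: t; exact: line_cvg riA.
by apply; apply: orth_orth_par_aff => // w /uA; rewrite dotZr => ->; rewrite mulr0.
Unshelve. all: by end_near.
Qed.

(** The rows of K are orthogonal to the kernel of the jacobian, hence to the tangent space, which
    sharpness identifies with [orth (par (subdiff J xbar))]. *)
Lemma partly_smooth_normal (J : 'rV[R]_n -> \bar R) (xbar vbar : 'rV[R]_n)
    (M : set 'rV[R]_n) :
  partly_smooth J xbar vbar M ->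
  exists (m : nat) (U : set 'rV[R]_n) (h : 'rV[R]_n -> 'rV[R]_m) (K : 'M[R]_(m, n)),
    [/\ nbhs xbar U, C1_on U h, forall z, U z -> (M z <-> h z = 0),
        K *m jacobian h xbar = 1%:M
      & forall j, orth (orth (par (subdiff J xbar))) (row j K)].
Proof.
move=> [_ [[Mx [m [h hM]]] _ _ tangent _]].
have tanker := tangent_space_sub_ker Mx hM.
have [U [Uo [hC1 _] MU surj]] := hM.
have [K KJ Kperp] : exists2 K : 'M[R]_(m, n), K *m jacobian h xbar = 1%:M &
    forall (v : 'rV_n) (w : 'rV_m), v *m jacobian h xbar = 0 -> dot v (w *m K) = 0.
  apply: surjective_right_inverse => w; have [u uw] := surj w.
  by exists u; rewrite -diff_jacobian.
exists m, U, h, K; split => //; first exact: open_nbhs_nbhs.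
move=> j u; rewrite -tangent => /tanker uJ.
by rewrite rowE; exact: Kperp.
Qed.

(* With d = w K, the two signs of b give |<row j K, d>| = O(tau |d|); as d is
   a combination of the rows of K with coefficients w = d A, |d|^2 is
   O(tau |d|^2). *)
Lemma normal_displacement_eq0 {m} (K : 'M[R]_(m, n)) (A : 'M[R]_(n, m))
    (eps C : R) :
  K *m A = 1%:M -> 0 < eps -> 0 <= C ->
  exists2 tau : R, 0 < tau & forall (w : 'rV[R]_m) (e : bool -> 'I_m -> 'rV[R]_n),
    `|w *m K| <= tau ->
    (forall b j, `|e b j - ((-1) ^+ b * eps) *: row j K| <= tau) ->
    (forall b j, dot (e b j) (w *m K) <= C * dot (w *m K) (w *m K)) ->
    w *m K = 0.
Proof.
move=> KA eps0 C0; have [c c0 cA] := norm_mulmx_le A.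
(* B collects the constants of the final estimate eps |d|^2 <= B tau |d|^2; tau is then chosen so
   that B tau <= eps / 2, which forces d = 0. *)
pose B : R := m%:R * c * (n%:R * (C + 1)).
have B0 : 0 <= B by rewrite !mulr_ge0 ?addr_ge0 // ltW.
have B10 : 0 < 2 * (B + 1) by rewrite mulr_gt0 // ltr_wpDl.
exists (eps / (2 * (B + 1))) => [|w e]; first by rewrite divr_gt0.
set tau := eps / _; set d := w *m K => dtau etau ed.
have tau0 : 0 < tau by rewrite divr_gt0.
have wd : `|w| <= c * `|d| by rewrite -{1}[w]mulmx1 -KA mulmxA; exact: cA.
(* Replacing e by its target costs n tau |d|, and C <d, d> <= C n |d|^2 <= C n tau |d| because |d|
   <= tau. *)
have signed (b : bool) j : (-1) ^+ b * (eps * dot (row j K) d) <= n%:R * (C + 1) * tau * `|d|.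
  rewrite mulrA -dotZl.
  have -> : ((-1) ^+ b * eps) *: row j K = e b j - (e b j - ((-1) ^+ b * eps) *: row j K).
    by rewrite opprB addrC subrK.
  rewrite dotBl; have := ed b j; have := norm_dot_le d d.
  have := norm_dot_le (e b j - ((-1) ^+ b * eps) *: row j K) d.
  rewrite ler_norml => /andP[+ _].
  rewrite ler_norml => + /andP[_ dd].
  have Cdd : C * dot d d <= C * (n%:R * tau * `|d|).
    rewrite ler_wpM2l // (le_trans dd) // ler_wpM2r //.
    by rewrite ler_wpM2l.
  have : n%:R * `|e b j - ((-1) ^+ b * eps) *: row j K| * `|d| <= n%:R * tau * `|d|.
    by rewrite ler_wpM2r // ler_wpM2l.
  lra.
pose q : 'rV[R]_m := \row_j dot (row j K) d.
have qd : eps * `|q| <= n%:R * (C + 1) * tau * `|d|.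
  rewrite mulrC -ler_pdivlMr //; apply: norm_le_coord => [|j].
    have t0 := ltW tau0; have e0 := ltW eps0; clearbody tau.
    by rewrite divr_ge0 ?mulr_ge0 ?addr_ge0.
  rewrite mxE ler_pdivlMr // mulrC -{1}(gtr0_norm eps0) -normrM ler_norml.
  have := signed false j; have := signed true j; rewrite !expr0 !expr1; lra.
have dd : eps * `|d| ^+ 2 <= B * tau * `|d| ^+ 2.
  apply: le_trans (ler_wpM2l (ltW eps0) (sqr_norm_le_dot d)) _.
  rewrite {1}/d dot_mulmx_rows -/q.
  have := norm_dot_le w q; rewrite ler_norml => /andP[_ wq].
  apply: le_trans (ler_wpM2l (ltW eps0) wq) _.
  have -> : eps * (m%:R * `|w| * `|q|) = m%:R * (`|w| * (eps * `|q|)) by ring.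
  have -> : B * tau * `|d| ^+ 2 =
      m%:R * ((c * `|d|) * (n%:R * (C + 1) * tau * `|d|)) by rewrite /B; ring.
  by rewrite ler_wpM2l // ler_pM // mulr_ge0 // ltW.
have Btau : B * tau <= eps / 2.
  rewrite /tau mulrA ler_pdivrMr // (_ : eps / 2 * _ = eps * (B + 1)); last by field.
  by rewrite mulrC ler_wpM2l ?lerDl // ltW.
have := ler_wpM2r (sqr_ge0 `|d|) Btau.
have := sqr_ge0 `|d| => d0 dd'; have : eps * `|d| ^+ 2 <= 0 by lra.
rewrite pmulr_rle0 // => d2; apply/eqP; rewrite -normr_eq0 -sqrf_eq0.
by rewrite eq_le d2.
Qed.

End Identification.

(** * Identification of the manifold from a proximal inequality *)

Section Main.
Context {R : realType} {n : nat}.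

(** The algorithm is abstracted into convergent slopes v and a global quadratic lower bound whose
    constant c is independent of k. *)
Lemma partly_smooth_identification (J : 'rV[R]_n -> \bar R)
    (xbar vbar : 'rV[R]_n) (M : set 'rV[R]_n) (x v : nat -> 'rV[R]_n) (c : R) :
  0 <= c -> partly_smooth J xbar vbar M -> ri (subdiff J xbar) vbar ->
  x @ \oo --> xbar -> v @ \oo --> vbar ->
  (forall k y,
    J (x k) + (dot (v k) (y - x k) - c * enorm (x k - y) ^+ 2)%:E <= J y)%E ->
  \forall k \near \oo, M (x k).
Proof.
move=> c0 psJ riv x_cvg v_cvg Jx.
have [m [U [h [K [xU hC1 MU KA Kperp]]]]] := partly_smooth_normal psJ.
have [vsub [[Mx _] [U2 [g [U2o gC2 Jg]]] [_ [r [r0 _ _ [er er0 Jprox]]]] _ [_ inner]]] := psJ.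
have U2x : nbhs xbar U2 by exact: open_nbhs_nbhs.
have hx : h xbar = 0 by apply/MU => //; exact: nbhs_singleton xU.
pose er' := er / (n%:R + 1).
have er'0 : 0 < er' by rewrite divr_gt0 // ltr_wpDl.
(* There are finitely many rows and signs, so one eps serves them all; b encodes the sign. The bound
   by [er'] keeps the perturbed subgradients within the radius of prox-regularity. *)
have [eps [eps0 epsA epsn]] : exists eps : R, [/\ 0 < eps,
    forall (b : bool) j, subdiff J xbar (vbar + ((-1) ^+ b * eps) *: row j K)
    & forall (b : bool) j, `|((-1) ^+ b * eps) *: row j K| < er'].
  pose u (bj : bool * 'I_m) := (-1) ^+ bj.1 *: row bj.2 K.
  have uE t b j : t *: u (b, j) = ((-1) ^+ b * t) *: row j K.
    by rewrite /u scalerA mulrC.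
  have nearA : \forall t \near (0 : R)^'+, forall bj,
      subdiff J xbar (vbar + t *: u bj).
    apply: (@filter_forall _ _ _ (0 : R)^'+ _) => -[b j].
    apply: ri_orth_orth_par => // z zpar.
    by rewrite dotZr (Kperp j z zpar) mulr0.
  have nearn : \forall t \near (0 : R)^'+, forall bj, `|t *: u bj| < er'.
    apply: (@filter_forall _ _ _ (0 : R)^'+ _) => bj.
    have u_cvg : t *: u bj @[t --> (0 : R)^'+] --> (0 : 'rV[R]_n).
      rewrite -[X in _ --> X](scale0r (u bj)); apply: cvgZr_tmp.
      by apply: cvg_at_right_filter; exact: cvg_id.
    by apply: cvgr_norm_lt u_cvg _ _; rewrite normr0.
  near (0 : R)^'+ => t; exists t; split.
  - by near: t; exact: nbhs_right_gt.
  - by move=> b j; rewrite -uE; move: (b, j); near: t.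
  - by move=> b j; rewrite -uE; move: (b, j); near: t.
pose good k := exists w : 'rV[R]_m,
  [/\ U (x k + w *m K), h (x k + w *m K) = 0 & `|w| <= 2 * `|h (x k)|].
have near_good : \forall k \near \oo, good k.
  exact: x_cvg (newton_correction xU hC1 hx KA).
(* Where the correction fails, the default pair (xbar, 0) keeps p k in M for every k, as
   [inner_limit] demands. *)
have /choice[pw pwP] : forall k, exists pw : 'rV[R]_n * 'rV[R]_m, M pw.1 /\
    (good k -> x k = pw.1 + pw.2 *m K /\ `|pw.2| <= 2 * `|h (x k)|).
  move=> k; have [[w [Uw hw wle]]|ngood] := pselect (good k); last by exists (xbar, 0).
  exists (x k + w *m K, - w) => /=; split; first exact/MU.
  by move=> _; rewrite mulNmx addrK normrN.
pose p k := (pw k).1; pose d k := (pw k).2 *m K.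
have Mp k : M (p k) by case: (pwP k).
have h_cvg : h (x k) @[k --> \oo] --> (0 : 'rV[R]_m).
  rewrite -hx; apply: continuous_cvg => //; apply: differentiable_continuous.
  by apply: hC1.1; exact: nbhs_singleton xU.
have d_cvg : d @ \oo --> (0 : 'rV[R]_n).
  have [cK cK0 Kle] := norm_mulmx_le K.
  apply/cvgrPdistC_lt => e e0.
  have e1 : 0 < e / (2 * cK) by rewrite divr_gt0 // mulr_gt0.
  have := h_cvg; move=> /cvgrPdistC_lt/(_ _ e1).
  apply: filterS2 near_good => k /(pwP k).2 [_ wle]; rewrite !subr0.
  rewrite ltr_pdivlMr ?mulr_gt0 // => hlt; apply: le_lt_trans (Kle _) _.
  apply: le_lt_trans (ler_wpM2l (ltW cK0) wle) _; lra.
have p_cvg : p @ \oo --> xbar.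
  have xd_cvg : x k - d k @[k --> \oo] --> xbar.
    by rewrite -[X in _ --> X]subr0; exact: cvgB.
  apply: cvg_trans xd_cvg; apply: near_eq_cvg.
  by apply: filterS near_good => k /(pwP k).2 [-> _]; rewrite addrK.
have inner_w (b : bool) j : exists w : nat -> 'rV[R]_n,
    (\forall k \near \oo, subdiff J (p k) (w k)) /\
    w @ \oo --> vbar + ((-1) ^+ b * eps) *: row j K.
  by have := epsA b j; rewrite -{1}inner; apply.
pose w b j := sval (cid (inner_w b j)).
have w_sub b j : \forall k \near \oo, subdiff J (p k) (w b j k).
  by rewrite /w; case: cid => ? [].
have w_cvg b j : w b j @ \oo --> vbar + ((-1) ^+ b * eps) *: row j K.
  by rewrite /w; case: cid => ? [].
clearbody w.
have C0 : 0 <= (2 * r)^-1 + c by rewrite addr_ge0 // invr_ge0 mulr_ge0 // ltW.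
have [tau tau0 disp] := normal_displacement_eq0 KA eps0 C0.
have gp_cvg : g (p k) @[k --> \oo] --> g xbar.
  apply: continuous_cvg => //; apply: differentiable_continuous.
  by apply: gC2.1.1; exact: nbhs_singleton U2x.
pose good_w k (bj : bool * 'I_m) := [/\ subdiff J (p k) (w bj.1 bj.2 k),
  `|w bj.1 bj.2 k - vbar| < er'
  & `|w bj.1 bj.2 k - v k - ((-1) ^+ bj.1 * eps) *: row bj.2 K| <= tau].
have near_w : \forall k \near \oo, forall bj, good_w k bj.
  apply: (@filter_forall _ _ _ \oo _) => -[b j]; rewrite /good_w /=.
  pose e := ((-1) ^+ b * eps) *: row j K.
  have wv_cvg : w b j k - v k @[k --> \oo] --> e.
    have -> : e = vbar + e - vbar by rewrite addrC addKr.
    exact: cvgB (w_cvg b j) v_cvg.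
  have wb_cvg : w b j k - vbar @[k --> \oo] --> e.
    have -> : e = vbar + e - vbar by rewrite addrC addKr.
    by apply: cvgB (w_cvg b j) _; exact: cvg_cst.
  near=> k; split.
  - by near: k; exact: w_sub.
  - by near: k; apply: cvgr_norm_lt wb_cvg _ _; exact: epsn.
  - apply: ltW; near: k; move/cvgrPdistC_lt: wv_cvg; exact.
near=> k.
have [xE _] : x k = p k + d k /\ `|(pw k).2| <= 2 * `|h (x k)|.
  by apply: (pwP k).2; near: k.
rewrite xE (_ : d k = 0) ?addr0 //.
have wk : forall bj, good_w k bj by near: k.
apply: (disp _ (fun b j => w b j k - v k)).
- have : `|d k - 0| < tau by near: k; move/cvgrPdistC_lt: d_cvg; exact.
  by rewrite subr0 => /ltW.
- by move=> b j; case: (wk (b, j)).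
move=> b j; have [/= wsub wer _] := wk (b, j).
have U2p : U2 (p k) by near: k; exact: p_cvg U2x.
have Jp := Jg _ U2p (Mp k).
have Jxbar := Jg _ (nbhs_singleton U2x) Mx.
have p_er : enorm (p k - xbar) < er.
  by apply: enorm_lt; near: k; move/cvgrPdistC_lt: p_cvg; exact.
have x_er : enorm (x k - xbar) < er.
  by apply: enorm_lt; near: k; move/cvgrPdistC_lt: x_cvg; exact.
have g_er : (`|J (p k) - J xbar| < er%:E)%E.
  rewrite Jp Jxbar -EFinB abse_EFin lte_fin.
  by near: k; move/cvgrPdistC_lt: gp_cvg; exact.
(* Prox-regularity at p k tested at x k, and the proximal inequality at x k tested at p k, add up to
   <w - v, d> <= ((2r)^-1 + c) |d|^2. *)
have low := Jprox (p k) (x k) (w b j k) p_er x_er g_er wsub (enorm_lt wer).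
have up := Jx k (p k).
rewrite Jp in low up; have := ereal_sandwich low up.
have dE : x k - p k = d k by rewrite xE addrC addKr.
have dNE : p k - x k = - d k by rewrite -dE opprB.
rewrite dE dNE -!enorm_sqr.
rewrite (_ : enorm (- d k) = enorm (d k)); last by rewrite -dNE -dE enormB.
rewrite dotNr dotBl; lra.
Unshelve. all: by end_near.
Qed.
End Main.

(** * The proximal inequality and the limits of the inertial quantities *)

Section Convergence.
Context {R : realType} {n : nat}.

(** Expanding |y - z|^2 around x in the minimality of x gives the inequality with (2g)^-1; enlarging
    this to (2 g0)^-1 makes the constant uniform over the step sizes. *)
Lemma prox_subgradient (J : 'rV[R]_n -> \bar R) (g g0 : R) (z x y : 'rV[R]_n) :
  proper_fun J -> 0 < g0 -> g0 <= g -> prox g J z x ->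
  (J x + (dot (g^-1 *: (z - x)) (y - x) - (2 * g0)^-1 * enorm (x - y) ^+ 2)%:E
     <= J y)%E.
Proof.
move=> [JNy [y0 Jy0]] g0_gt0 g0g proxx.
have g_gt0 : 0 < g by exact: lt_le_trans g0g.
(* The point y0 is a competitor with finite value. *)
have xfin : J x \is a fin_num.
  have := JNy x; have := proxx y0; have := Jy0; have := JNy y0.
  case: (J y0) (J x) => [r| |] [r'| |] //= _ _.
  by rewrite gt0_muley ?lte_fin.
have := proxx y; have := JNy y; move: xfin; case: (J x) (J y) => [jx| |] [jy| |] // _ _.
  rewrite -!EFinM -!EFinD !lee_fin !enorm_sqr.
  have -> : dot (y - z) (y - z) =
      dot (x - z) (x - z) + dot (x - y) (x - y) - 2 * dot (z - x) (y - x).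
    rewrite !(dotBl, dotBr) (dotC y x) (dotC z x) (dotC z y); ring.
  rewrite dotZl => H; rewrite -(ler_pM2l g_gt0).
  have gg : dot (x - y) (x - y) / 2 <= g * ((2 * g0)^-1 * dot (x - y) (x - y)).
    rewrite invfM [leLHS]mulrC !mulrA ler_wpM2r ?dot_ge0 //.
    by rewrite [g / 2]mulrC -mulrA ler_peMr // ler_pdivlMr // mul1r.
  have -> : g * (jx + (g^-1 * dot (z - x) (y - x) - (2 * g0)^-1 * dot (x - y) (x - y)))
     = g * jx + dot (z - x) (y - x) - g * ((2 * g0)^-1 * dot (x - y) (x - y)).
    by field; rewrite !gt_eqF.
  lra.
by rewrite leey.
Qed.

Lemma cvg_bounded_scale0 (c : nat -> R) (B : R) (u : nat -> 'rV[R]_n) :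
  (forall k, `|c k| <= B) -> u @ \oo --> (0 : 'rV[R]_n) ->
  (fun k => c k *: u k) @ \oo --> (0 : 'rV[R]_n).
Proof.
move=> cB u0; have B1 : 0 < B + 1.
  by rewrite ltr_wpDl // (le_trans (normr_ge0 (c 0%N))).
apply/cvgrPdistC_lt => e e0.
have /cvgrPdistC_lt/(_ (e / (B + 1)) (divr_gt0 e0 B1)) := u0.
apply: filterS => k; rewrite !subr0 ltr_pdivlMr // => lte.
rewrite normrZ; apply: le_lt_trans lte; rewrite mulrC ler_wpM2l //.
by rewrite (le_trans (cB k)) // lerDl.
Qed.

(** Each increment is a difference of two shifts of x, hence tends to 0, and the coefficients are
    bounded. *)
Lemma inertial_point_cvg (s : nat) (c : 'I_s -> nat -> R) (B : R)
    (x : nat -> 'rV[R]_n) (l : 'rV[R]_n) :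
  (forall i k, `|c i k| <= B) -> x @ \oo --> l ->
  inertial_point c x @ \oo --> l.
Proof.
move=> cB xl; rewrite -[X in _ --> X]addr0; apply: cvgD => //.
have xsub i : x (k - i)%N @[k --> \oo] --> l.
  by apply: cvg_comp xl; exact: cvg_subnr.
elim: (index_enum _) => [|i r IHr].
  by under eq_fun do rewrite big_nil; exact: cvg_cst.
rewrite -[X in _ --> X]addr0; under eq_fun do rewrite big_cons.
apply: cvgD => //.
apply: (@cvg_bounded_scale0 _ B) => //.
rewrite -(subrr l); apply: cvgB => //.
by under eq_fun do rewrite -subnDA; exact: xsub.
Qed.

Lemma lipschitz_gradient_cvg (F : 'rV[R]_n -> R) (L : R) (y : nat -> 'rV[R]_n)
    (l : 'rV[R]_n) :
  lipschitz_gradient L F -> 0 < L -> y @ \oo --> l ->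
  (fun k => grad F (y k)) @ \oo --> grad F l.
Proof.
move=> [_ Flip] L0 yl; apply/cvgrPdistC_lt => e e0.
have Ln : 0 < L * (n%:R + 1) by rewrite mulr_gt0 // ltr_wpDl.
have /cvgrPdistC_lt/(_ (e / (L * (n%:R + 1))) (divr_gt0 e0 Ln)) := yl.
apply: filterS => k; rewrite invfM mulrA => /enorm_lt ylt.
apply: le_lt_trans (norm_le_enorm _) _; apply: le_lt_trans (Flip _ _) _.
by rewrite mulrC -ltr_pdivlMr.
Qed.

End Convergence.

(** * Application to the iterates of MiFB *)

Theorem theorem3p2 (R : realType) (n : nat)
    (Rf : 'rV[R]_n -> \bar R) (F : 'rV[R]_n -> R) (L : R)
    (Rf_proper : proper_fun Rf) (Rf_lsc : lower_semicontinuous Rf)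
    (Rf_bounded : bounded_below Rf)
    (L_gt0 : 0 < L) (F_smooth : lipschitz_gradient L F)
    (Phi_proper : proper_fun (objective Rf F)) (Phi_lsc : lower_semicontinuous (objective Rf F))
    (Phi_KL : KL_function (objective Rf F)) (Phi_bounded : bounded_below (objective Rf F))
    (s : nat) (s_ge1 : (1 <= s)%N)
    (gamma : nat -> R) (gamma_lo gamma_hi : R)
    (gamma_lo_gt0 : 0 < gamma_lo)
    (gamma_bounds : forall k, gamma_lo <= gamma k <= gamma_hi)
    (gamma_hi_lt : gamma_hi < 1 / L)
    (a b : 'I_s -> nat -> R)
    (a_bounds : forall i k, -1 < a i k <= 2)
    (b_bounds : forall i k, -1 < b i k <= 2)
    (mu nu : R) (mu_gt0 : 0 < mu) (nu_gt0 : 0 < nu)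
    (descent : (0 < beta_inf L mu nu gamma
                    - \sum_(i < s) alpha_sup L mu nu gamma a b i)%E)
    (x : nat -> 'rV[R]_n) (x_MiFB : MiFB Rf F gamma a b x)
    (xstar : 'rV[R]_n) (x_cvg : x @ \oo --> xstar)
    (xstar_crit : crit (objective Rf F) xstar)
    (M : set 'rV[R]_n)
    (Rf_psf : partly_smooth Rf xstar (- grad F xstar) M)
    (nondegenerate : ri (subdiff Rf xstar) (- grad F xstar)) :
  \forall k \near \oo, M (x k).
Proof.
have g_lo k : gamma_lo <= gamma k by case/andP: (gamma_bounds k).
have g_gt0 k : 0 < gamma k by exact: lt_le_trans (g_lo k).
pose ya k := inertial_point a x k; pose yb k := inertial_point b x k.
have bound2 (r : R) : -1 < r <= 2 -> `|r| <= 2.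
  by move=> /andP[r1 r2]; rewrite ler_norml; lra.
have ya_cvg : ya @ \oo --> xstar.
  by apply: (inertial_point_cvg (B := 2)) => // i k; exact: bound2.
have yb_cvg : yb @ \oo --> xstar.
  by apply: (inertial_point_cvg (B := 2)) => // i k; exact: bound2.
have xS_cvg : x k.+1 @[k --> \oo] --> xstar by rewrite cvg_shiftS.
(* The proximal inequality concerns x k.+1, so identification is applied to the shifted sequence. *)
apply: near_inftyS.
pose v k := (gamma k)^-1 *: (ya k - gamma k *: grad F (yb k) - x k.+1).
apply: (@partly_smooth_identification _ _ Rf xstar (- grad F xstar) M
  (fun k => x k.+1) v (2 * gamma_lo)^-1) => //.
- by rewrite invr_ge0 mulr_ge0 // ltW.
(* The first term vanishes in the limit, since its factor is at most [gamma_lo^-1] and [ya k] and x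
   k.+1 share the limit xstar. *)
- have -> : v = fun k => (gamma k)^-1 *: (ya k - x k.+1) - grad F (yb k).
    apply/funext => k; rewrite /v addrAC scalerBr scalerA mulVf ?gt_eqF //.
    by rewrite scale1r.
  rewrite -[X in _ --> X]add0r; apply: cvgB; last first.
    exact: lipschitz_gradient_cvg F_smooth L_gt0 yb_cvg.
  apply: (@cvg_bounded_scale0 _ _ _ gamma_lo^-1) => [k|].
    by rewrite gtr0_norm ?invr_gt0 // lef_pV2 ?posrE.
  by rewrite -(subrr xstar); exact: cvgB.
- move=> k y; exact: prox_subgradient (x_MiFB k).
Qed.
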